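(* There is an absolute constant $c>0$ such that the following holds. For any $\varepsilon>0$ there is a $\delta=\delta(\varepsilon)\ge c\varepsilon$ (i.e. $\delta=\Omega(\varepsilon)$) such that for every $n$-vertex graph $G$, if $\mathrm{itm}(G)<(1-\varepsilon)\frac{n}{3}$, then $\log\mathrm{mis}(G)<\left(\frac{1}{3}\log 3-\delta\right)n$.
   Context: $\mathrm{mis}(G)$ denotes the number of maximal independent sets of $G$, and $\log=\log_2$. An induced triangle matching of $G$ is an induced subgraph of $G$ that is a vertex-disjoint union of triangles; $\mathrm{itm}(G)$ is the number of triangles in a largest induced triangle matching of $G$. *)

(* Defs.v *)
From mathcomp Require Import all_boot all_order all_algebra.
From mathcomp Require Import reals exp.

Set Implicit Arguments.
Unset Strict Implicit.
Unset Printing Implicit Defensive.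

Import Order.TTheory GRing.Theory Num.Theory.

Record sgraph := SGraph {
  vertex : finType;
  adj : rel vertex;
  adj_sym : symmetric adj;
  adj_irrefl : irreflexive adj
}.

Definition independent (G : sgraph) (S : {set vertex G}) : bool :=
  [forall x in S, forall y in S, ~~ adj x y].

Definition mis (G : sgraph) : nat :=
  #|[set S : {set vertex G} | maxset (@independent G) S]|.

Definition triangle (G : sgraph) (B : {set vertex G}) : bool :=
  (#|B| == 3) && [forall x in B, forall y in B, (x != y) ==> adj x y].

(* An induced triangle matching is given by its set P of triangles: they are
   vertex-disjoint, and the subgraph induced on their union has no edge other
   than those of the triangles. *)
Definition induced_triangle_matching (G : sgraph)
    (P : {set {set vertex G}}) : bool :=
  [&& trivIset P,
      [forall B in P, triangle B] &
      [forall x in cover P, forall y in cover P,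
         adj x y ==> [exists B in P, (x \in B) && (y \in B)]]].

Definition itm (G : sgraph) : nat :=
  \max_(P : {set {set vertex G}} | induced_triangle_matching P) #|P|.

Definition log2 (R : realType) (x : R) : R := (ln x / ln 2)%R.

(* Main.v *)
(* The inequality [mis G <= a ^ n * b ^ itm G], with [a < 3 ^ (1/3)] and
   [a ^ 3 * b = 3], yields the theorem after taking logarithms. It is proved by
   induction, removing closed neighbourhoods. A maximal independent set meets
   the closed neighbourhood of a vertex [v] of minimum degree [d], which gives
   at most [d + 1] branches losing at least [d + 1] vertices each. Since
   [k <= a ^ k] for [k <> 3], this suffices unless [d = 2]. If [d = 2], then
   - if [v] lies in an isolated triangle, [mis] is multiplied by 3 and [itm]
     increases by 1;
   - otherwise one of the three branches loses at least 4 vertices: this is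
     clear if a neighbour of [v] has degree at least 3; if not, the two
     neighbours [x], [y] of [v] are nonadjacent and a set avoiding [v] and [x]
     contains [y] and the other neighbour of [x]. *)
Require Import Defs.
From mathcomp Require Import all_boot all_order all_algebra.
From mathcomp Require Import ring lra.
From mathcomp Require Import reals exp.

Set Implicit Arguments.
Unset Strict Implicit.
Unset Printing Implicit Defensive.

Import Order.TTheory GRing.Theory Num.Theory.
Local Open Scope ring_scope.

(** * Cardinalities of families of sets *)

Lemma leq_card_bigcup (I T : finType) (D : {pred I}) (F : I -> {set T}) :
  (#|\bigcup_(i in D) F i| <= \sum_(i in D) #|F i|)%N.
Proof.
elim/big_rec2: _ => [|i n A _ leAn]; first by rewrite cards0.
by apply: leq_trans (leq_card_setU _ _) _; rewrite leq_add2l.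
Qed.

(** Deleting [w] is injective on sets that contain [w]. *)
Lemma leq_card_setD1 (T : finType) (w : T) (F H : {set {set T}}) :
  {in F, forall S : {set T}, w \in S} ->
  {in F, forall S : {set T}, S :\ w \in H} ->
  (#|F| <= #|H|)%N.
Proof.
move=> Fw FH; rewrite -(card_in_imset (f := fun S : {set T} => S :\ w)).
  by apply: subset_leq_card; apply/subsetP => _ /imsetP[S SF ->]; apply: FH.
by move=> S S' SF S'F eqS; rewrite -(setD1K (Fw _ SF)) eqS setD1K // Fw.
Qed.

(** * Maximal independent sets and triangle matchings of induced subgraphs *)

Section InducedSubgraphs.

Variable G : sgraph.
Implicit Types (U S A : {set vertex G}) (u v w x y : vertex G).

Definition closed_nbhd w : {set vertex G} := [set u | (u == w) || adj w u].

(** The maximal independent sets of the subgraph induced on [U], with maximality expressed as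
    domination. Keeping [G] fixed and varying [U] lets the induction delete vertices without
    building new graphs. *)
Definition mis_in U : {set {set vertex G}} :=
  [set S : {set vertex G} | [&& S \subset U, independent S &
     [forall u in U :\: S, exists s in S, adj u s]]].

Definition itm_in U : nat :=
  \max_(P : {set {set vertex G}} |
     induced_triangle_matching P && (cover P \subset U)) #|P|.

Lemma mem_closed_nbhd u w : (u \in closed_nbhd w) = (u == w) || adj w u.
Proof. by rewrite inE. Qed.

Lemma closed_nbhd_refl w : w \in closed_nbhd w.
Proof. by rewrite mem_closed_nbhd eqxx. Qed.

Lemma closed_nbhdC u w : (u \in closed_nbhd w) = (w \in closed_nbhd u).
Proof. by rewrite !mem_closed_nbhd eq_sym adj_sym. Qed.

Lemma mis_inP U S :
  reflect [/\ S \subset U, {in S &, forall x y, ~~ adj x y} &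
             forall u, u \in U -> u \notin S -> exists2 s, s \in S & adj u s]
          (S \in mis_in U).
Proof.
rewrite inE; apply: (iffP and3P) => -[sSU indS domS]; split => //.
- by move=> x y xS yS; move/forall_inP: indS => /(_ x xS)/forall_inP/(_ y yS).
- move=> u uU uS; have /exists_inP[s sS us] :
    [exists s in S, adj u s] by move/forall_inP: domS; apply; rewrite inE uS.
  by exists s.
- by apply/forall_inP => x xS; apply/forall_inP => y yS; apply: indS.
- apply/forall_inP => u; rewrite inE => /andP[uS uU].
  by have [s sS us] := domS u uU uS; apply/exists_inP; exists s.
Qed.

Lemma mis_le_mis_in : (mis G <= #|mis_in [set: vertex G]|)%N.
Proof.
apply: subset_leq_card; apply/subsetP => S; rewrite inE => /maxsetP[indS maxS].
have indSP : {in S &, forall x y, ~~ adj x y}.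
  by move=> x y xS yS; move/forall_inP: indS => /(_ x xS)/forall_inP/(_ y yS).
apply/mis_inP; split=> // u _ uS; apply/exists_inP.
apply: contraNT uS => /exists_inPn nadj.
suff <- : u |: S = S by rewrite setU11.
apply: maxS; last exact: subsetU1.
apply/forall_inP => x /setU1P xS; apply/forall_inP => y /setU1P yS.
case: xS yS => [->|xS] [->|yS];
  [by rewrite adj_irrefl | exact: nadj | | exact: indSP].
by rewrite adj_sym nadj.
Qed.

Lemma mis_gt0 : (0 < mis G)%N.
Proof.
have ind0 : independent (set0 : {set vertex G}).
  by apply/forall_inP => x; rewrite inE.
have [S maxS _] := maxset_exists ind0.
by apply/card_gt0P; exists S; rewrite inE.
Qed.

(** A vertex outside the closed neighbourhood of [w] is not dominated by [w], so its dominating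
    neighbour survives the deletion of [w]. *)
Lemma mis_in_setD1 U S w :
  S \in mis_in U -> w \in S -> S :\ w \in mis_in (U :\: closed_nbhd w).
Proof.
move=> /mis_inP[sSU indS domS] wS; apply/mis_inP; split.
- apply/subsetP => u /setD1P[uw uS].
  by rewrite inE mem_closed_nbhd (negPf uw) indS // (subsetP sSU).
- by move=> x y /setD1P[_ xS] /setD1P[_ yS]; apply: indS.
move=> u; rewrite !inE negb_or negb_and negbK => /andP[/andP[uw wu] uU].
rewrite (negPf uw) => /= uS; have [s sS us] := domS u uU uS.
exists s => //; rewrite !inE sS andbT.
by apply: contraNneq wu => <-; rewrite adj_sym.
Qed.

Lemma card_mis_in_mem U w :
  (#|[set S in mis_in U | w \in S]| <= #|mis_in (U :\: closed_nbhd w)|)%N.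
Proof.
apply: (leq_card_setD1 (w := w)) => S; rewrite inE => /andP[SU wS] //.
exact: mis_in_setD1.
Qed.

Lemma card_mis_in_mem2 U w z : z != w ->
  (#|[set S in mis_in U | (w \in S) && (z \in S)]| <=
   #|mis_in (U :\: closed_nbhd w :\: closed_nbhd z)|)%N.
Proof.
move=> zw; apply: leq_trans (card_mis_in_mem _ z).
apply: (leq_card_setD1 (w := w)) => S; rewrite inE => /and3P[SU wS zS] //.
by rewrite inE (mis_in_setD1 SU wS) !inE zw.
Qed.

Lemma mis_in_meets_nbhd U S v : v \in U -> S \in mis_in U ->
  exists2 w, w \in U :&: closed_nbhd v & w \in S.
Proof.
move=> vU /mis_inP[sSU _ domS]; have [vS|vS] := boolP (v \in S).
  by exists v; rewrite // inE vU closed_nbhd_refl.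
have [s sS vs] := domS v vU vS; exists s => //.
by rewrite inE mem_closed_nbhd vs orbT (subsetP sSU).
Qed.

Lemma card_mis_in_leq_sum U v : v \in U ->
  (#|mis_in U| <=
   \sum_(w in U :&: closed_nbhd v) #|mis_in (U :\: closed_nbhd w)|)%N.
Proof.
move=> vU.
apply: (@leq_trans (\sum_(w in U :&: closed_nbhd v)
                      #|[set S in mis_in U | w \in S]|)); last first.
  by apply: leq_sum => w _; apply: card_mis_in_mem.
apply: leq_trans (leq_card_bigcup _ _).
apply: subset_leq_card; apply/subsetP => S SU.
have [w wD wS] := mis_in_meets_nbhd vU SU.
by apply/bigcupP; exists w; rewrite // inE SU.
Qed.

Lemma itm_in_sub U U' : U \subset U' -> (itm_in U <= itm_in U')%N.
Proof.
move=> sUU'; apply/bigop.bigmax_leqP => P /andP[itmP PU].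
by apply: (bigop.bigmax_sup P); rewrite ?itmP ?(subset_trans PU).
Qed.

Lemma itm_inT : itm_in [set: vertex G] = itm G.
Proof. by apply: eq_bigl => P; rewrite subsetT andbT. Qed.

(** No edge of [U] leaves [A], so adding [A] to an optimal matching of [U :\: A] keeps it
    induced. *)
Lemma itm_in_setD_triangle U A : A \subset U -> triangle A ->
    {in A, forall w, U :&: closed_nbhd w = A} ->
  (itm_in (U :\: A) < itm_in U)%N.
Proof.
move=> sAU triA isolA.
(* The empty matching is admissible, so the maximum defining [itm_in] is attained. *)
have P0 : induced_triangle_matching (set0 : {set {set vertex G}})
          && (cover set0 \subset U :\: A).
  rewrite /induced_triangle_matching /trivIset /cover !big_set0 cards0 eqxx.
  rewrite sub0set andbT /=; apply/andP; split; apply/forall_inP => B;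
  by rewrite inE.
have [P /andP[/and3P[tivP triP edgeP] PU] ->] :
    exists2 P : {set {set vertex G}},
      induced_triangle_matching P && (cover P \subset U :\: A) &
      itm_in (U :\: A) = #|P|.
  rewrite /itm_in (bigop.bigmax_eq_arg set0) //.
  by case: arg_maxnP => // P ? _; exists P.
have A0 : A != set0 by case/andP: triA => /eqP cA _; rewrite -card_gt0 cA.
have disj B : B \in P -> [disjoint A & B].
  move=> BP; rewrite disjoint_sym disjoints_subset.
  apply/subsetP => u uB; have : u \in cover P by apply/bigcupP; exists B.
  by move/(subsetP PU); rewrite !inE => /andP[].
have AP : A \notin P.
  by apply/negP => /disj; rewrite -setI_eq0 setIid (negPf A0).
have cov : cover (A |: P) = A :|: cover P.
  by rewrite /cover bigcup_setU big_set1.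
have cross u s : u \in A -> s \in cover P -> ~~ adj u s.
  move=> uA /(subsetP PU); rewrite inE => /andP[sA sU].
  apply: contra sA => us; rewrite -(isolA u uA) inE sU.
  by rewrite mem_closed_nbhd us orbT.
apply: (bigop.bigmax_sup (A |: P)); last by rewrite cardsU1 AP.
apply/andP; split; last first.
  by rewrite cov subUset sAU (subset_trans PU) ?subsetDl.
apply/and3P; split.
- apply/trivIsetP => B C /setU1P[->|BP] /setU1P[->|CP] BC.
  + by rewrite eqxx in BC.
  + exact: disj.
  + by rewrite disjoint_sym disj.
  + by move/trivIsetP: tivP; apply.
- apply/forall_inP => B /setU1P[->//|BP]; exact: (forall_inP triP).
- rewrite cov; apply/forall_inP => u /setUP uC; apply/forall_inP => s /setUP sC.
  apply/implyP => us; apply/exists_inP.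
  case: uC sC => [uA|uP] [sA|sP].
  + by exists A; rewrite ?setU11 ?uA.
  + by rewrite (negPf (cross _ _ uA sP)) in us.
  + by rewrite adj_sym (negPf (cross _ _ sA uP)) in us.
  + have /implyP/(_ us) := forall_inP (forall_inP edgeP u uP) s sP.
    move=> /exists_inP[B BP Bus].
    by exists B; rewrite // setU1r.
Qed.

(** A set avoiding [v] and [x] must meet the closed neighbourhood of [v] in [y] and that of [x] in
    [z]. *)
Lemma card_mis_in_degree2 U v x y z :
    v \in U -> U :&: closed_nbhd v = [set v; x; y] ->
    U :&: closed_nbhd x = [set v; x; z] ->
  (#|mis_in U| <= #|mis_in (U :\: closed_nbhd v)|
     + #|mis_in (U :\: closed_nbhd x)|
     + #|[set S in mis_in U | (y \in S) && (z \in S)]|)%N.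
Proof.
move=> vU Dv Dx.
apply: (@leq_trans (#|[set S in mis_in U | v \in S]|
    + #|[set S in mis_in U | x \in S]|
    + #|[set S in mis_in U | (y \in S) && (z \in S)]|)); last first.
  by rewrite leq_add2r leq_add // card_mis_in_mem.
apply: (@leq_trans #|[set S in mis_in U | v \in S]
    :|: [set S in mis_in U | x \in S]
    :|: [set S in mis_in U | (y \in S) && (z \in S)]|); last first.
  apply: leq_trans (leq_card_setU _ _) _.
  by rewrite leq_add2r leq_card_setU.
apply: subset_leq_card; apply/subsetP => S SU.
have [vS|vS] := boolP (v \in S).
  by apply/setUP; left; apply/setUP; left; rewrite inE SU.
have [xS|xS] := boolP (x \in S).
  by apply/setUP; left; apply/setUP; right; rewrite inE SU.
have xU : x \in U.
  have : x \in [set v; x; y] by rewrite !inE eqxx orbT.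
  by rewrite -Dv => /setIP[].
have yS : y \in S.
  have [w] := mis_in_meets_nbhd vU SU.
  rewrite Dv !inE -orbA.
  by move=> /or3P[] /eqP -> //; rewrite ?(negPf vS) ?(negPf xS).
have zS : z \in S.
  have [w] := mis_in_meets_nbhd xU SU.
  rewrite Dx !inE -orbA.
  by move=> /or3P[] /eqP -> //; rewrite ?(negPf vS) ?(negPf xS).
by apply/setUP; right; rewrite inE SU yS.
Qed.

Lemma card_mis_in_adj U y z : adj y z ->
  #|[set S in mis_in U | (y \in S) && (z \in S)]| = 0%N.
Proof.
move=> yz; apply: eq_card0 => S; rewrite inE.
apply/negP => /and3P[/mis_inP[_ indS _] yS zS].
by move: (indS y z yS zS); rewrite yz.
Qed.

End InducedSubgraphs.

(* Any value in the interval [2 ^ (1/2), 3 ^ (1/3)) would do. *)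
Definition growth (R : realType) : R := 10 / 7.
Definition bonus (R : realType) : R := 3 / growth R ^+ 3.

(** * The weighted bound, by induction on the vertex set *)

Section WeightedBound.

Variables (R : realType) (G : sgraph).
Implicit Types (U A B : {set vertex G}).
Local Notation a := (growth R).
Local Notation b := (bonus R).

Definition weight U : R := a ^+ #|U| * b ^+ itm_in U.

Lemma growth_gt0 : 0 < a. Proof. by rewrite /growth; lra. Qed.

Lemma growth_ge1 : 1 <= a. Proof. by rewrite /growth; lra. Qed.

Lemma bonus_gt1 : 1 < b.
Proof. by rewrite /bonus /growth !exprS expr0; lra. Qed.

(** Makes the isolated triangle case exact: three vertices and one unit of [itm_in] pay for a factor
    of 3. *)
Lemma growth3_bonus : a ^+ 3 * b = 3.
Proof. by rewrite /bonus mulrC divfK // expf_neq0 // gt_eqF // growth_gt0. Qed.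

Lemma weight_ge0 U : 0 <= weight U.
Proof.
by rewrite mulr_ge0 // exprn_ge0 // ltW ?growth_gt0 // (lt_trans _ bonus_gt1).
Qed.

Lemma leq_weight U (m t : nat) : (m <= #|U|)%N -> (t <= itm_in U)%N ->
  a ^+ m * b ^+ t <= weight U.
Proof.
have := growth_ge1; have := bonus_gt1 => b1 a1 leU let_.
by apply: ler_pM; rewrite ?exprn_ge0 ?ler_weXn2l //; lra.
Qed.

(** Deleting vertices cannot increase [itm_in], and the bonus exceeds 1, so only the vertex count
    has to be tracked. *)
Lemma weight_setD U B m : (m <= #|U :&: B|)%N ->
  weight (U :\: B) <= weight U / a ^+ m.
Proof.
move=> leB; rewrite ler_pdivlMr ?exprn_gt0 ?growth_gt0 //.
rewrite mulrAC -exprD; apply: leq_weight; last exact/itm_in_sub/subsetDl.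
by rewrite -[#|U|](cardsID B) addnC leq_add2r.
Qed.

Lemma weight_setD_triangle U A : A \subset U -> triangle A ->
    {in A, forall w, U :&: closed_nbhd w = A} ->
  3 * weight (U :\: A) <= weight U.
Proof.
move=> sAU triA isolA; rewrite -growth3_bonus /weight mulrACA -exprD -exprS.
apply: leq_weight; last exact: itm_in_setD_triangle.
have /andP[/eqP <- _] := triA.
by rewrite -[#|U|](cardsID A) (setIidPr sAU).
Qed.

(** The cases 2 and 4 are the tight ones, with powers 100/49 and 10000/2401. From 4 on, each step
    adds 3/7 of the power, which is more than 1. *)
Lemma natr_le_growthX (k : nat) : k != 3%N -> k%:R <= a ^+ k.
Proof.
case: k => [|[|[|[//|k]]]] _; rewrite /growth ?expr0 ?expr1 ?expr2; try lra.
elim: k => [|k IHk]; first by rewrite !exprS expr0; lra.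
rewrite exprS -natr1; have k0 : 0 <= k%:R :> R by [].
by move: IHk; rewrite -[k.+4]addn4 natrD; set p := _ ^+ _ => IHk; lra.
Qed.

(** The recurrence for three branches that lose 3, 3 and 4 vertices. *)
Lemma growth_branch : 2 / a ^+ 3 + 1 / a ^+ 4 <= 1.
Proof. by rewrite /growth !exprS expr0; lra. Qed.

Lemma growth_branch_mul (W : R) : 0 <= W ->
  W / a ^+ 3 + W / a ^+ 3 + W / a ^+ 4 <= W.
Proof.
move=> W0; have := ler_wpM2l W0 growth_branch; rewrite mulr1.
by apply: le_trans; rewrite le_eqVlt; apply/orP; left; apply/eqP; ring.
Qed.

Lemma card_mis_in_le U : #|mis_in U|%:R <= weight U.
Proof.
have [n] := ubnP #|U|; elim: n => // n IHn in U *; rewrite ltnS => leUn.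
have a0 : 0 < a by exact: growth_gt0.
have W0 := weight_ge0 U.
have [->|[v0 v0U]] := set_0Vmem U.
  suff -> : mis_in set0 = [set set0 : {set vertex G}].
    rewrite cards1 /weight cards0 mul1r exprn_ege1 //; exact/ltW/bonus_gt1.
  apply/setP => S; rewrite in_set1; apply/mis_inP/eqP => [[]|->].
    by rewrite subset0 => /eqP.
  by rewrite sub0set; split => // [x y|u]; rewrite inE.
have IH B : (0 < #|U :&: B|)%N ->
    #|mis_in (U :\: B)|%:R <= weight (U :\: B).
  move=> B0; apply: IHn; apply: leq_trans leUn.
  by rewrite -[#|U|](cardsID B) -add1n leq_add2r.
have bnd B m : (0 < m)%N -> (m <= #|U :&: B|)%N ->
    #|mis_in (U :\: B)|%:R <= weight U / a ^+ m.
  by move=> m0 leB; apply: le_trans (weight_setD leB); apply/IH/leq_trans/leB.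
(* [D w] contains [w] itself, so its size is one more than the degree of [w] in [U]; size 3 below
   means degree 2. *)
pose D w := U :&: closed_nbhd w.
have [v vU minv] :
    exists2 v, v \in U & forall w, w \in U -> (#|D v| <= #|D w|)%N.
  by case: (arg_minnP (fun w => #|D w|) v0U) => v; exists v.
have DU w : w \in D v -> w \in U by case/setIP.
have memD w : w \in U -> w \in D w.
  by move=> wU; rewrite inE wU closed_nbhd_refl.
have lesum : #|mis_in U|%:R <=
    \sum_(w in D v) #|mis_in (U :\: closed_nbhd w)|%:R :> R.
  by rewrite -natr_sum ler_nat; apply: card_mis_in_leq_sum.
have Dv0 : (0 < #|D v|)%N by apply/card_gt0P; exists v; apply: memD.
have [D3|D3] := eqVneq #|D v| 3%N; last first.
  apply: le_trans lesum _.
  apply: (@le_trans _ _ (\sum_(w in D v) weight U / a ^+ #|D v|)).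
    by apply: ler_sum => w wD; apply: bnd => //; apply/minv/DU.
  rewrite sumr_const -mulr_natr mulrAC ler_pdivrMr ?exprn_gt0 //.
  by rewrite ler_wpM2l ?natr_le_growthX.
have ge3 w : w \in D v -> (3 <= #|D w|)%N by move=> wD; rewrite -D3 minv ?DU.
(* If some [w] in [D v] has degree at least 3, its branch loses 4 vertices and the other two lose at
   least 3 each. *)
have [/exists_inP[w wD w4]|/exists_inPn deg2] :=
    boolP [exists w in D v, (4 <= #|D w|)%N].
  apply: le_trans lesum (le_trans _ (growth_branch_mul W0)).
  rewrite (bigD1 w) //= addrC; apply: lerD; last exact: bnd.
  apply: (@le_trans _ _ (\sum_(u in D v | u != w) weight U / a ^+ 3)).
    by apply: ler_sum => u /andP[uD _]; apply: bnd => //; apply: ge3.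
  rewrite sumr_const -mulr2n.
  suff -> : #|[pred u in D v | u != w]| = 2%N by [].
  move: D3; rewrite (cardD1 w) wD => -[<-].
  by apply: eq_card => u; rewrite !inE andbC.
have eq3 w : w \in D v -> #|D w| = 3%N.
  by move=> wD; apply/eqP; rewrite eqn_leq ge3 // andbT leqNgt deg2.
have /cards2P[x [y [xy Dvxy]]] : #|D v :\ v| == 2%N.
  by move: D3; rewrite (cardsD1 v) memD // add1n => -[->].
have Dvs : D v = [set v; x; y].
  by rewrite -(setD1K (memD v vU)) Dvxy setUA.
have xD : x \in D v by rewrite Dvs !inE eqxx orbT.
have yD : y \in D v by rewrite Dvs !inE eqxx !orbT.
have [xv yv] : x != v /\ y != v.
  have : x \in D v :\ v by rewrite Dvxy !inE eqxx.
  have : y \in D v :\ v by rewrite Dvxy !inE eqxx orbT.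
  by rewrite !in_setD1 => /andP[-> _] /andP[-> _].
have [vx vy] : adj v x /\ adj v y.
  move: xD yD; rewrite !in_setI !mem_closed_nbhd (negPf xv) (negPf yv) /=.
  by move=> /andP[_ ->] /andP[_ ->].
(* If [x] and [y] are adjacent, [D v] is a clique; each [D w] with [w] in [D v] contains it and also
   has size 3, so the triangle is isolated. *)
have [yx|nyx] := boolP (adj y x).
  have cliqueD : {in D v &, forall u w, u \in closed_nbhd w}.
    have xvE : adj x v by rewrite adj_sym.
    have yvE : adj y v by rewrite adj_sym.
    have xyE : adj x y by rewrite adj_sym.
    move=> u w; rewrite Dvs !inE -!orbA => /or3P[] /eqP -> /or3P[] /eqP ->;
    by rewrite ?eqxx ?vx ?vy ?yx ?xvE ?yvE ?xyE ?orbT.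
  have isolD : {in D v, forall w, D w = D v}.
    move=> w wD; apply/esym/eqP; rewrite eqEcard eq3 // D3 leqnn andbT.
    by apply/subsetP => u uD; rewrite inE DU ?cliqueD.
  have triD : triangle (D v).
    rewrite /triangle D3; apply/forall_inP => u uD; apply/forall_inP => w wD.
    by have := cliqueD w u wD uD; rewrite mem_closed_nbhd eq_sym -implyNb.
  apply: le_trans lesum (le_trans _ (weight_setD_triangle _ triD isolD)).
    rewrite (eq_bigr (fun=> #|mis_in (U :\: D v)|%:R)) => [|w wD].
      rewrite sumr_const D3 -[_ *+ 3]mulr_natl.
      by rewrite ler_wpM2l // IH // setIA setIid.
    by rewrite -(isolD w wD) setDIr setDv set0U.
  exact: subsetIl.
have vDx : v \in D x by rewrite inE vU closed_nbhdC; case/setIP: xD.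
have xDx : x \in D x by rewrite memD ?DU.
(* Here [z] is the other neighbour of [x] in [U]; it differs from [y] because [x] and [y] are
   nonadjacent. *)
have /cards1P[z Dz] : #|D x :\ v :\ x| == 1%N.
  have := eq3 x xD; rewrite (cardsD1 v) vDx (cardsD1 x) in_setD1 xv xDx.
  by rewrite !add1n => -[->].
have Dxs : D x = [set v; x; z].
  have xDxv : x \in D x :\ v by rewrite in_setD1 xv.
  by rewrite -(setD1K vDx) -(setD1K xDxv) Dz setUA.
have zDx : z \in D x by rewrite Dxs !inE eqxx !orbT.
have zy : z != y.
  apply: contraNneq nyx => zy; move: zDx.
  by rewrite zy inE mem_closed_nbhd eq_sym (negPf xy) adj_sym => /andP[].
apply: le_trans (growth_branch_mul W0).
apply: (@le_trans _ _ (_ + _ + _)%:R).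
  by rewrite ler_nat; apply: (card_mis_in_degree2 vU Dvs Dxs).
rewrite !natrD !lerD //; first by apply: bnd; rewrite // ge3 ?memD.
  by apply: bnd; rewrite // ge3.
(* If [y] and [z] are adjacent, the third branch is empty. Otherwise [z] lies outside [D y], so [z]
   and the three vertices of [D y] are all lost. *)
have [yz|nyz] := boolP (adj y z).
  by rewrite card_mis_in_adj // divr_ge0 // exprn_ge0 // ltW.
apply: (@le_trans _ _ #|mis_in (U :\: (closed_nbhd y :|: closed_nbhd z))|%:R).
  by rewrite ler_nat -setDDl; apply: card_mis_in_mem2.
apply: bnd => //.
have <- : #|z |: D y| = 4%N.
  by rewrite cardsU1 eq3 // inE mem_closed_nbhd (negPf zy) (negPf nyz) andbF.
apply: subset_leq_card; apply/subsetP => u /setU1P[->|/setIP[uU uy]].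
  by rewrite inE (setIP zDx).1 in_setU closed_nbhd_refl orbT.
by rewrite inE uU in_setU uy.
Qed.

End WeightedBound.

(** * Taking logarithms *)

Theorem theorem1p3 (R : realType) :
  exists c : R, 0 < c /\
    forall eps : R, 0 < eps ->
      exists delta : R, c * eps <= delta /\
        forall (n : nat) (G : sgraph), #|vertex G| = n ->
          (itm G)%:R < (1 - eps) * (n%:R / 3) ->
          log2 ((mis G)%:R : R) < (1 / 3 * log2 3 - delta) * n%:R.
Proof.
have a0 := growth_gt0 R; have b1 := bonus_gt1 R.
have b0 : 0 < bonus R by apply: lt_trans b1.
have L0 : 0 < ln (bonus R) by apply: ln_gt0.
have ln20 : 0 < ln 2 :> R by apply: ln_gt0; lra.
have ln3 : ln 3 = 3 * ln (growth R) + ln (bonus R).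
  rewrite -[in LHS](growth3_bonus R) lnM ?posrE ?exprn_gt0 //.
  by rewrite lnXn // mulr_natl.
(* Each triangle missing from the matching saves [log2] of the bonus, and more than [eps * n / 3] of
   them are missing from the maximum [n / 3]. *)
exists (ln (bonus R) / 3 / ln 2); split; first by rewrite !divr_gt0.
move=> eps eps0; exists (ln (bonus R) / 3 / ln 2 * eps).
split=> // n G cardG itmG.
have mis0 : 0 < (mis G)%:R :> R by rewrite ltr0n mis_gt0.
have : (mis G)%:R <= growth R ^+ n * bonus R ^+ itm G.
  apply: le_trans (_ : _ <= #|mis_in [set: vertex G]|%:R) _.
    by rewrite ler_nat mis_le_mis_in.
  apply: le_trans (card_mis_in_le R _) _.
  by rewrite /weight cardsT cardG itm_inT.
rewrite -ler_ln ?posrE ?mulr_gt0 ?exprn_gt0 //.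
rewrite lnM ?posrE ?exprn_gt0 // !lnXn //.
rewrite -[_ *+ n]mulr_natl -[_ *+ itm G]mulr_natl.
move=> le_ln; rewrite /log2 ltr_pdivrMr // ln3.
have -> : (1 / 3 * ((3 * ln (growth R) + ln (bonus R)) / ln 2)
    - ln (bonus R) / 3 / ln 2 * eps) * n%:R * ln 2 =
  n%:R * ln (growth R) + (1 - eps) * (n%:R / 3) * ln (bonus R).
  by field; rewrite gt_eqF.
(* Strictness comes from the hypothesis on [itm G], multiplied by the positive [ln (bonus R)]. *)
by apply: le_lt_trans le_ln _; rewrite ltrD2l ltr_pM2r.
Qed.
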